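(* Let $q$ be a prime power, $r\ge 2$ an integer, and $u$ a positive integer with $u \mid \frac{q^r-1}{q-1}$. Let $\mathcal{M}\subseteq\Delta\left(x^{(q-1)u},y^{q^{r-1}}\right)$ be a set of monomials that is closed under divisibility. Then there exists a repair scheme of $\mathrm{ev}(\mathcal{M})$ for one erasure with bandwidth at most $$|\mathcal{X}_u|-1+(u-1)(r-1).$$
   Context: Let $Tr(y)=y^{q^{r-1}}+y^{q^{r-2}}+\cdots+y^q+y$ and let $\mathcal{X}_u=\{(\alpha,\beta)\in\mathbb{F}_{q^r}^2:\alpha^u=Tr(\beta)\}=\{P_1,\dots,P_n\}$ be the set of rational points of the (affine) extended norm-trace curve. The evaluation map is $\mathrm{ev}:\mathbb{F}_{q^r}[x,y]\to\mathbb{F}_{q^r}^n$, $f\mapsto(f(P_1),\dots,f(P_n))$, and for a set $\mathcal{M}$ of monomials, $\mathrm{ev}(\mathcal{M})$ is the image under $\mathrm{ev}$ of the $\mathbb{F}_{q^r}$-span of $\mathcal{M}$. $\mathcal{M}$ is closed under divisibility if $M\in\mathcal{M}$ and $M'\mid M$ imply $M'\in\mathcal{M}$. $\Delta(x^i,y^j)$ denotes the set of monomials in $x,y$ that are multiples of neither $x^i$ nor $y^j$. Repair schemes: elements of $\mathbb{F}_{q^r}$ are called symbols and elements of $\mathbb{F}_q$ subsymbols. A (linear, exact) repair scheme for one erasure of a code $C\subseteq\mathbb{F}_{q^r}^n$ is a procedure that, for any position $i^*\in\{1,\dots,n\}$, recovers the entry $c_{i^*}$ of any codeword $c\in C$ from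 subsymbols computed from the other entries. That is, for each $i^*$ there are nonnegative integers $b_i$ and $\mathbb{F}_q$-linear maps $\varphi_i:\mathbb{F}_{q^r}\to\mathbb{F}_q^{b_i}$ for $i\ne i^*$, and an $\mathbb{F}_q$-linear map $\psi:\prod_{i\neq i^*}\mathbb{F}_q^{b_i}\to\mathbb{F}_{q^r}$, such that $c_{i^*}=\psi\big((\varphi_i(c_i))_{i\ne i^*}\big)$ for all $c\in C$. The bandwidth is the number of subsymbols required, i.e. $\sum_{i\ne i^*}b_i$; having bandwidth at most $B$ means that this number is at most $B$ for every erased position $i^*$. *)

(* Defs.v *)
From HB Require Import structures.
From mathcomp Require Import all_boot all_order all_algebra all_field.
From mathcomp.multinomials Require Import mpoly.

Set Implicit Arguments.
Unset Strict Implicit.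
Unset Printing Implicit Defensive.

Import GRing.Theory.
Local Open Scope ring_scope.

(* Monomials in x and y are exponent vectors in 'X_{1..2}, with x the variable *)
(* of index 0 and y that of index 1; (m1 <= m2)%MM is divisibility.            *)
Definition ix : 'I_2 := ord0.
Definition iy : 'I_2 := ord_max.

Definition closed_under_divisibility (M : {pred 'X_{1..2}}) : Prop :=
  forall m m', m \in M -> (m' <= m)%MM -> m' \in M.

Definition Delta (i j : nat) : {pred 'X_{1..2}} :=
  [pred m | ~~ (U_(ix) *+ i <= m)%MM & ~~ (U_(iy) *+ j <= m)%MM].

Definition Tr (K : nzRingType) (q r : nat) (y : K) : K :=
  \sum_(i < r) y ^+ (q ^ i).

Definition ntcurve (K : finFieldType) (q r u : nat) : {set K * K} :=
  [set P : K * K | P.1 ^+ u == Tr q r P.2].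

(* The points of X are enumerated as P_i = enum_val i, for i : 'I_#|X|. *)
Definition ev (K : finFieldType) (X : {set K * K}) (f : {mpoly K[2]}) :
    'rV[K]_#|X| :=
  \row_i f.@[tnth [tuple (enum_val i).1; (enum_val i).2]].

(* The polynomials in the span of M are those whose support lies in M. *)
Definition ev_code (K : finFieldType) (X : {set K * K})
    (M : {pred 'X_{1..2}}) (c : 'rV[K]_#|X|) : Prop :=
  exists2 f : {mpoly K[2]}, {subset msupp f <= M} & c = ev X f.

Section RepairSchemes.

(* F is the field of subsymbols and K the F-space of symbols. *)
Variables (F : fieldType) (K : vectType F) (n : nat).

(* The positions other than i0 are the lift i0 i, for i : 'I_n.-1. The product *)
(* of the spaces F^(b_i) is the space of row vectors of length \sum_i b_i, in  *)
(* which a family of vectors is represented by its concatenation \mxrow.       *)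
Record repair_at (C : 'rV[K]_n -> Prop) (i0 : 'I_n) := RepairAt {
  nsub : 'I_n.-1 -> nat;
  query : forall i, {linear K -> 'rV[F]_(nsub i)};
  recover : {linear 'rV[F]_(\sum_i nsub i) -> K};
  repair_correct : forall c, C c ->
    c 0 i0 = recover (\mxrow_i query i (c 0 (lift i0 i)))
}.

Definition repair_scheme (C : 'rV[K]_n -> Prop) := forall i0, repair_at C i0.

Definition bandwidth_at_most (C : 'rV[K]_n -> Prop) (S : repair_scheme C)
    (B : nat) : Prop :=
  forall i0, (\sum_i nsub (S i0) i <= B)%N.

End RepairSchemes.

(* Main.v *)
(* Let D = q^(r-1). Over each abscissa a with a^u in F_q there are exactly D      *)
(* points of the curve, the roots of Tr(y) - a^u, whose derivative is 1. Hence,  *)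
(* by Lagrange interpolation, the sum of g over such a fibre is the coefficient  *)
(* of y^(D-1) in g mod (Tr(y) - a^u); if deg g <= 2D-2, this coefficient does    *)
(* not depend on a. The abscissas are the (q-1)u+1 roots of x^((q-1)u+1) - x, so *)
(* interpolation again gives nonzero weights w(a) with sum_a w(a) a^i = 0 for    *)
(* i < (q-1)u. Consequently, for every h(y) of degree < D, the word              *)
(* (w(a) h(b))_(a,b) is orthogonal to ev(M).                                     *)
(* To repair the position (a0,b0), take h = Tr(t(y-b0))/(y-b0) for all t and     *)
(* apply Tr to the parity checks. A point with b <> b0 contributes               *)
(* Tr(t(b-b0)) Tr(w(a) c/(b-b0)), so one subsymbol suffices; the at most u-1     *)
(* other points with b = b0 send all their r subsymbols. The answers determine   *)
(* Tr(w(a0) t c0) for all t, hence c0.                                           *)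
Require Import Defs.
From HB Require Import structures.
From mathcomp Require Import all_boot all_order all_algebra all_fingroup.
From mathcomp Require Import all_solvable all_field.
From mathcomp.multinomials Require Import mpoly.

Set Implicit Arguments.
Unset Strict Implicit.
Unset Printing Implicit Defensive.

Import GRing.Theory.
Local Open Scope ring_scope.

(** [sum_roots_deriv] is used twice: along a trace fibre it gives [sum_Tr_fibre], over the abscissas
    [sum_weight]. Together they give the dual words of [ntcurve_dual]. [repair_from_functionals]
    turns traces of such parity checks into a repair scheme. The cost is one subsymbol for each of
    the |X| - 1 other points, plus r - 1 more for each of the at most u - 1 others that share the
    erased ordinate. *)

(** * Lagrange interpolation at simple rational roots *)

Section SplitPolynomials.

Variables (K : finFieldType) (G : {poly K}).
Hypotheses (G_monic : G \is monic) (G_split : G %| 'X^#|K| - 'X).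

Lemma prod_roots : exists2 s : seq K, uniq s & G = \prod_(a <- s) ('X - a%:P).
Proof.
have [|m Gm] := @dvdp_prod_XsubC _ _ (enum K) id G.
  by rewrite big_enum -finField_genPoly.
exists (mask m (enum K)); first exact/mask_uniq/enum_uniq.
by apply/eqP; rewrite -eqp_monic // monic_prod_XsubC.
Qed.

Lemma deriv_root_cofactor a : root G a -> (G %/ ('X - a%:P)).[a] = G^`().[a].
Proof.
move=> Ga; have /divpK GE : 'X - a%:P %| G by rewrite dvdp_XsubCl.
by rewrite -{2}GE derivM derivXsubC !hornerE subrr mulr0 add0r.
Qed.

(** The roots are simple, since [G] divides a product of distinct linear factors. *)
Lemma deriv_root_neq0 a : root G a -> G^`().[a] != 0.
Proof.
move=> Ga; rewrite -deriv_root_cofactor // -rootE.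
have [s s_uniq GE] := prod_roots.
have a_s : a \in s by rewrite -root_prod_XsubC -GE.
rewrite GE (big_rem a) //= mulrC mulpK ?polyXsubC_eq0 //.
by rewrite root_prod_XsubC mem_rem_uniqF.
Qed.

(* Lagrange interpolation of f at the roots of G, read off in degree (size G).-2. *)
Lemma sum_roots_deriv (f : {poly K}) : (size f < size G)%N ->
  \sum_(a | root G a) f.[a] / G^`().[a] = f`_(size G).-2.
Proof.
move=> size_f; pose L a := G %/ ('X - a%:P).
have [s s_uniq GE] := prod_roots.
have sizeG : size G = (size s).+1 by rewrite GE size_prod_XsubC.
have in_s a : root G a = (a \in s) by rewrite GE root_prod_XsubC.
have size_L a : size (L a) = size s.
  by rewrite size_divp ?polyXsubC_eq0 // size_XsubC sizeG subn1.
(* The Lagrange interpolant: [L a] vanishes at the roots other than a and equals G'(a) at a. *)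
pose g := \sum_(a | root G a) (f.[a] / G^`().[a]) *: L a.
have gE a : root G a -> g.[a] = f.[a].
  move=> Ga; rewrite /g (bigD1 a) //= hornerD horner_sum big1 => [|b /andP[Gb ba]].
    rewrite addr0 hornerZ deriv_root_cofactor // divfK //.
    exact: deriv_root_neq0.
  rewrite hornerZ; apply/eqP; rewrite mulf_eq0; apply/orP; right.
  have /divpK GbE : 'X - b%:P %| G by rewrite dvdp_XsubCl.
  move: (rootP Ga); rewrite -{1}GbE hornerM !hornerE => /eqP.
  by rewrite mulf_eq0 subr_eq0 [a == b]eq_sym (negPf ba) orbF.
have size_g : (size g <= size s)%N.
  apply: (leq_trans (size_sum _ _ _)); apply/bigmax_leqP => a _.
  by rewrite (leq_trans (size_scale_leq _ _)) ?size_L.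
have fg : f = g.
  apply/eqP; rewrite -subr_eq0; apply: contraT => fg0.
  have /(max_poly_roots fg0)/(_ s_uniq) : all (root (f - g)) s.
    by apply/allP => a; rewrite -in_s => /gE ga; rewrite rootE !hornerE ga subrr.
  rewrite ltnNge (leq_trans (size_polyD _ _)) // size_polyN geq_max size_g.
  by rewrite andbT -ltnS -sizeG.
rewrite [f in RHS]fg coef_sum; apply: eq_bigr => a Ga.
rewrite coefZ sizeG /= -(size_L a).
suff /monicP : L a \is monic by rewrite lead_coefE => ->; rewrite mulr1.
by rewrite -(monicMr _ (monicXsubC a)) divpK ?dvdp_XsubCl.
Qed.

End SplitPolynomials.

(** * The trace polynomial, its fibres and the repair polynomials *)

Section TracePolynomial.

Variables (K : finFieldType) (q r : nat).
Hypotheses (q_gt1 : (1 < q)%N) (r_gt0 : (0 < r)%N).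
Hypotheses (cardK : #|K| = (q ^ r)%N) (q_pchar : [pchar K].-nat q).

Let D := (q ^ (r - 1))%N.

Let expq_gt0 i : (0 < q ^ i)%N. Proof. by rewrite expn_gt0 ltnW. Qed.

Let D_gt0 : (0 < D)%N. Proof. exact: expq_gt0. Qed.

#[local] Hint Resolve expq_gt0 D_gt0 : core.

Lemma TrD (x y : K) : Tr q r (x + y) = Tr q r x + Tr q r y.
Proof.
rewrite /Tr -big_split; apply: eq_bigr => i _.
by rewrite exprDn_pchar // pnatX q_pchar.
Qed.

Lemma TrZ (c x : K) : c ^+ q = c -> Tr q r (c * x) = c * Tr q r x.
Proof.
move=> cq; rewrite /Tr mulr_sumr; apply: eq_bigr => i _; rewrite exprMn.
congr (_ * _); elim: (nat_of_ord i) => [|k IHk]; first by rewrite expn0 expr1.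
by rewrite expnSr exprM IHk.
Qed.

(** Frobenius shifts the terms of the trace by one, so only the two end terms differ. The ring is
    general because both [K] and [{poly K}] are needed. *)
Lemma expr_Tr (R : comNzRingType) (x : R) : [pchar R].-nat q ->
  Tr q r x ^+ q = Tr q r x + (x ^+ (q ^ r) - x).
Proof.
move=> qR; rewrite /Tr.
have -> : (\sum_(i < r) x ^+ (q ^ i)) ^+ q = \sum_(i < r) x ^+ (q ^ i.+1).
  elim/big_rec2: _ => [|i y z _ <-]; first by rewrite expr0n eqn0Ngt ltnW.
  by rewrite exprDn_pchar // -exprM expnSr.
case: r r_gt0 => // k _; rewrite big_ord_recr [in RHS]big_ord_recl /= expn0 expr1.
by rewrite [X in _ = X + _]addrC -[RHS]addrA subrKC.
Qed.

Lemma Tr_fixed (x : K) : Tr q r x ^+ q = Tr q r x.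
Proof. by rewrite expr_Tr // -cardK expf_card subrr addr0. Qed.

Lemma horner_TrX (x : K) : (Tr q r 'X).[x] = Tr q r x.
Proof. by rewrite horner_sum; apply: eq_bigr => i _; rewrite hornerXn. Qed.

Lemma size_TrX : size (Tr q r 'X : {poly K}) = D.+1.
Proof.
rewrite /Tr /D; case: r r_gt0 => // k _; rewrite subn1 /= big_ord_recr /=.
rewrite addrC size_polyDl ?size_polyXn // ltnS.
apply: (leq_trans (size_sum _ _ _)); apply/bigmax_leqP => i _.
by rewrite size_polyXn ltn_exp2l.
Qed.

Lemma lead_coef_TrX : (Tr q r 'X : {poly K})`_D = 1.
Proof.
rewrite /Tr /D coef_sum; case: r r_gt0 => // k _; rewrite subn1 big_ord_recr /=.
rewrite coefXn eqxx big1 ?add0r // => i _; rewrite coefXn eqn_exp2l //.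
by rewrite gtn_eqF.
Qed.

Lemma deriv_TrX : (Tr q r 'X : {poly K})^`() = 1.
Proof.
rewrite /Tr raddf_sum; case: r r_gt0 => // k _.
rewrite big_ord_recl /= derivXn expn0 expr0 mulr1n big1 ?addr0 // => i _.
have [p p_pr pK] := finPcharP K.
rewrite derivXn -mulr_natr natrX exprS -polyC_natr.
suff /eqP-> : q%:R == 0 :> K by rewrite polyC0 mul0r mulr0.
rewrite -(dvdn_pcharf pK).
move: q_pchar; rewrite (eq_pnat _ (pcharf_eq pK)) => /p_natP[[|e] qE].
  by move: q_gt1; rewrite qE.
by rewrite qE expnS dvdn_mulr.
Qed.

(** The degree q^(r-1) is too small for all q^r elements to be roots. *)
Lemma ex_Tr_neq0 : exists y : K, Tr q r y != 0.
Proof.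
apply/existsP/contraT; rewrite negb_exists => /forallP Tr_eq0.
have T0 : (Tr q r 'X : {poly K}) != 0 by rewrite -size_poly_eq0 size_TrX.
have T_roots : all (root (Tr q r 'X)) (enum K).
  by apply/allP => y _; rewrite rootE horner_TrX; have := Tr_eq0 y; rewrite negbK.
have := max_poly_roots T0 T_roots (enum_uniq K).
rewrite -cardE cardK size_TrX ltnS leq_exp2l //.
by case: r r_gt0 => // k _; rewrite subn1 ltnn.
Qed.

(* (Tr X - s) ^ q - (Tr X - s) = X ^ (q ^ r) - X. *)
Lemma TrX_split (s : K) : s ^+ q = s -> Tr q r 'X - s%:P %| 'X^#|K| - 'X.
Proof.
move=> sq; have qP : [pchar {poly K}].-nat q by rewrite (eq_pnat _ (pchar_poly K)).
suff -> : 'X^#|K| - 'X = (Tr q r 'X - s%:P) ^+ q - (Tr q r 'X - s%:P).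
  by rewrite dvdp_sub // dvdp_exp // ltnW.
have TE : Tr q r 'X = (Tr q r 'X - s%:P) + s%:P by rewrite subrK.
have := expr_Tr 'X qP; rewrite {1}TE exprDn_pchar // -polyC_exp sq cardK.
by move/(canRL (addrK _)) ->; rewrite opprB subrKA [X in _ = X - _]addrC addrK.
Qed.

Lemma sum_Tr_fibre (g : {poly K}) (s : K) :
    (size g <= D + D.-1)%N -> s ^+ q = s ->
  \sum_(b | Tr q r b == s) g.[b] = (g %% Tr q r 'X)`_(D.-1).
Proof.
move=> size_g sq; set T : {poly K} := Tr q r 'X.
have sizeT : size T = D.+1 := size_TrX.
have leadT : T`_D = 1 := lead_coef_TrX.
have T0 : T != 0 by rewrite -size_poly_eq0 sizeT.
have sizeTs : size (T - s%:P) = D.+1.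
  by rewrite size_polyDl ?sizeT // size_polyN (leq_ltn_trans (size_polyC_leq1 _)) //.
have Ts_monic : T - s%:P \is monic.
  rewrite monicE lead_coefE sizeTs coefB leadT coefC.
  by rewrite gtn_eqF ?subr0.
(* On the fibre T equals s, so f agrees with g there. The quotient has degree at most D - 2, so s
   does not affect the coefficient of degree D - 1. *)
pose f := s *: (g %/ T) + g %% T.
have size_gT : (size (g %/ T)%R <= D.-1)%N.
  by rewrite size_divp // sizeT leq_subLR.
have size_f : (size f < size (T - s%:P)%R)%N.
  rewrite sizeTs ltnS (leq_trans (size_polyD _ _)) // geq_max.
  rewrite (leq_trans (size_scale_leq _ _)) ?(leq_trans size_gT) ?leq_pred //=.
  by rewrite -ltnS -sizeT ltn_modp.
have := sum_roots_deriv Ts_monic (TrX_split sq) size_f.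
rewrite sizeTs coefD coefZ (nth_default _ size_gT) mulr0 add0r => <-.
apply: eq_big => [b|b /eqP Tb]; first by rewrite rootE !hornerE horner_TrX subr_eq0.
rewrite derivB derivC subr0 deriv_TrX hornerC divr1 {1}(divp_eq g T).
by rewrite hornerD hornerM horner_TrX Tb hornerD hornerZ mulrC.
Qed.

(** This is Tr(t(X - b0))/(X - b0), divided term by term so that it also has a value at b0. *)
Definition repair_poly (t b0 : K) : {poly K} :=
  \sum_(i < r) t ^+ (q ^ i) *: ('X - b0%:P) ^+ (q ^ i).-1.

Lemma size_repair_poly t b0 : (size (repair_poly t b0) <= D)%N.
Proof.
apply: (leq_trans (size_sum _ _ _)); apply/bigmax_leqP => i _.
rewrite (leq_trans (size_scale_leq _ _)) // size_exp_XsubC prednK //.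
by rewrite /D leq_exp2l // subn1 -ltnS prednK.
Qed.

Lemma horner_repair_poly t b0 b :
  (repair_poly t b0).[b] * (b - b0) = Tr q r (t * (b - b0)).
Proof.
rewrite horner_sum mulr_suml; apply: eq_bigr => i _.
by rewrite hornerZ horner_exp hornerXsubC exprMn -mulrA -exprSr prednK.
Qed.

Lemma horner_repair_poly_center t b0 : (repair_poly t b0).[b0] = t.
Proof.
rewrite horner_sum; case: r r_gt0 => // k _; rewrite big_ord_recl big1 => [|i _].
  by rewrite hornerZ expr1 expr0 hornerC mulr1 addr0.
rewrite hornerZ horner_exp hornerXsubC subrr expr0n -subn1 subn_eq0.
by rewrite leqNgt /= /bump -[X in (X < _)%N](expn0 q) ltn_exp2l //= mulr0.
Qed.

(** * Abscissas, weights and dual words *)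

Variable u : nat.
Hypotheses (u_gt0 : (0 < u)%N) (u_dvd : (u %| (q ^ r - 1) %/ (q - 1))%N).

Let m := ((q - 1) * u)%N.

Definition abscissa_poly : {poly K} := 'X^(m.+1) - 'X.

Definition weight (a : K) : K := (abscissa_poly^`().[a])^-1.

Let m_gt0 : (0 < m)%N. Proof. by rewrite muln_gt0 subn_gt0 q_gt1. Qed.

Lemma size_abscissa_poly : size abscissa_poly = m.+2.
Proof.
by rewrite size_polyDl ?size_polyXn // size_polyN size_polyX !ltnS.
Qed.

Lemma abscissa_poly_monic : abscissa_poly \is monic.
Proof.
rewrite monicE lead_coefE size_abscissa_poly coefB coefXn coefX eqxx.
by rewrite eqSS gtn_eqF // subr0.
Qed.

(** The condition on u gives m | q^r - 1, hence X^m - 1 divides X^(q^r-1) - 1. *)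
Lemma abscissa_poly_split : abscissa_poly %| 'X^#|K| - 'X.
Proof.
have /dvdnP[k kE] : (m %| q ^ r - 1)%N.
  have qd : (q - 1 %| q ^ r - 1)%N.
    by rewrite -{2}(exp1n r) subn_exp dvdn_mulr.
  by rewrite -(divnK qd) /m mulnC dvdn_pmul2r // subn_gt0.
have -> : #|K| = (m * k).+1.
  by rewrite cardK mulnC -kE subn1 prednK.
have XE n : 'X^(n.+1) - 'X = 'X * ('X^n - 1) :> {poly K}.
  by rewrite mulrBr mulr1 exprS.
rewrite /abscissa_poly !XE dvdp_mul2l ?polyX_eq0 //.
by rewrite exprM [X in _ %| X]subrX1 dvdp_mulr.
Qed.

(** a^(uq) - a^u is the value of the polynomial times a^(u-1), a factor that can only add the root
    0, already present. *)
Lemma root_abscissa_poly (a : K) :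
  root abscissa_poly a = ((a ^+ u) ^+ q == a ^+ u).
Proof.
have -> : (a ^+ u) ^+ q = a ^+ m.+1 * a ^+ u.-1.
  rewrite -exprM -exprD addSnnS prednK // /m -mulSnr subn1 prednK ?(ltnW q_gt1) //.
  by rewrite mulnC.
have -> : a ^+ u = a * a ^+ u.-1 by rewrite -exprS prednK.
rewrite rootE !hornerE -[RHS]subr_eq0 -mulrBl mulf_eq0 expf_eq0.
case: eqP => //= Ga; case: (a =P 0) Ga => [->|_ _]; last by rewrite andbF.
by rewrite expr0n subrr.
Qed.

Lemma weight_neq0 (a : K) : (a ^+ u) ^+ q = a ^+ u -> weight a != 0.
Proof.
move=> /eqP; rewrite -root_abscissa_poly => Ga; rewrite invr_eq0.
exact: deriv_root_neq0 abscissa_poly_monic abscissa_poly_split _ Ga.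
Qed.

(** Interpolation returns the coefficient of degree m, which is 0 for X^i with i < m. *)
Lemma sum_weight (i : nat) : (i < m)%N ->
  \sum_(a | (a ^+ u) ^+ q == a ^+ u) weight a * a ^+ i = 0.
Proof.
move=> im.
have := sum_roots_deriv abscissa_poly_monic abscissa_poly_split (f := 'X^i).
rewrite size_abscissa_poly size_polyXn coefXn gtn_eqF // mulr0n => sum0.
rewrite -[RHS]sum0; last by rewrite !ltnS ltnW.
apply: eq_big => [a|a _]; first by rewrite root_abscissa_poly.
by rewrite mulrC hornerXn.
Qed.

Lemma ntcurve_dual (h : {poly K}) (i j : nat) :
    (size h <= D)%N -> (i < m)%N -> (j < D)%N ->
  \sum_(P in ntcurve K q r u)
     weight P.1 * h.[P.2] * (P.1 ^+ i * P.2 ^+ j) = 0.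
Proof.
move=> size_h im jD; pose g := h * 'X^j.
have size_g : (size g <= D + D.-1)%N.
  have [h0|h0] := eqVneq h 0; first by rewrite /g h0 mul0r size_poly0.
  by rewrite size_mulXn // addnC leq_add // -ltnS prednK // (leq_trans _ jD).
have sum0 : \sum_(a | (a ^+ u) ^+ q == a ^+ u)
    weight a * a ^+ i * (g %% Tr q r 'X)`_(D.-1) = 0.
  by rewrite -mulr_suml sum_weight // mul0r.
rewrite -[RHS]sum0.
rewrite (eq_bigr (fun P => weight P.1 * P.1 ^+ i * g.[P.2])); last first.
  by move=> P _; rewrite hornerM hornerXn mulrACA mulrA.
(* On the curve x^u is a trace, hence fixed by Frobenius; the points are thus grouped over the roots
   of [abscissa_poly]. *)
rewrite (eq_bigl (fun P : K * K =>
    ((P.1 ^+ u) ^+ q == P.1 ^+ u) && (Tr q r P.2 == P.1 ^+ u))).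
  rewrite -(pair_big_dep (fun a => (a ^+ u) ^+ q == a ^+ u)
    (fun a b => Tr q r b == a ^+ u) (fun a b => weight a * a ^+ i * g.[b])) /=.
  by apply: eq_bigr => a /eqP aq; rewrite -mulr_sumr (sum_Tr_fibre size_g aq).
move=> P /=; rewrite inE eq_sym andb_idl // => /eqP <-.
by rewrite Tr_fixed.
Qed.

End TracePolynomial.

Lemma card_ntcurve_fibre (K : finFieldType) (q r u : nat) (b : K) : (0 < u)%N ->
  (#|[set P in ntcurve K q r u | P.2 == b]| <= u)%N.
Proof.
move=> u_gt0; set A := [set P in _ | _].
have fst_inj : {in A &, injective fst}.
  by move=> [a c] [a' c']; rewrite !inE /= => /andP[_ /eqP->] /andP[_ /eqP->] ->.
pose p : {poly K} := 'X^u - (Tr q r b)%:P.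
have size_p : size p = u.+1 by rewrite size_XnsubC.
rewrite -(card_in_imset fst_inj) cardE -ltnS -size_p.
apply: max_poly_roots (enum_uniq _); first by rewrite -size_poly_eq0 size_p.
apply/allP => a; rewrite mem_enum => /imsetP[[a' c]].
rewrite !inE /= => /andP[/eqP aE /eqP cb] ->.
by rewrite rootE !hornerE aE cb subrr.
Qed.

Definition linear_of (F : fieldType) (U V : lmodType F) (f : U -> V)
    (f_lin : linear f) : {linear U -> V} :=
  HB.pack f (GRing.isLinear.Build F U V *:%R f f_lin).

(** * Linear algebra of repair *)

Section LinearRepair.

Variables (F : fieldType) (K : vectType F) (T : finType).

(** The query is chosen before t: a single download of k subsymbols serves all parity checks. *)
Definition answered_by (k : nat) (psi : T -> K -> F) : Prop :=
  exists (query : {linear K -> 'rV[F]_k}) (rho : T -> {linear 'rV[F]_k -> F^o}),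
    forall t x, psi t x = rho t (query x).

Lemma answered_by1 (a : T -> F) (f : {linear K -> F^o}) (psi : T -> K -> F) :
  (forall t x, psi t x = a t * f x) -> answered_by 1 psi.
Proof.
move=> psiE; have q_lin : linear (fun x => const_mx (f x) : 'rV[F]_1).
  by move=> c x y; apply/rowP => i; rewrite !mxE linearP.
have rho_lin t : linear (fun v : 'rV[F]_1 => a t * v 0 0 : F^o).
  by move=> c v w; rewrite !mxE mulrDr mulrCA.
exists (linear_of q_lin), (fun t => linear_of (rho_lin t)) => t x.
by rewrite psiE /= mxE.
Qed.

Lemma answered_by_dim (psi : T -> {linear K -> F^o}) :
  answered_by (\dim {:K}) psi.
Proof.
pose b := vbasis {:K}.
have q_lin : linear (fun x : K => \row_i coord b i x).
  by move=> c x y; apply/rowP => i; rewrite !mxE linearP.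
have rho_lin t : linear (fun v : 'rV[F]_(\dim {:K}) => \sum_i v 0 i *: psi t b`_i).
  move=> c v w; rewrite scaler_sumr -big_split; apply: eq_bigr => i _.
  by rewrite !mxE scalerDl scalerA.
exists (linear_of q_lin), (fun t => linear_of (rho_lin t)) => t x /=.
rewrite {1}(coord_vbasis (memvf x)) linear_sum; apply: eq_bigr => i _.
by rewrite linearZ mxE.
Qed.

(* A family phi of functionals that separates K is inverted linearly. *)
Lemma repair_from_functionals (n : nat) (C : 'rV[K]_n -> Prop) (i0 : 'I_n)
    (k : 'I_n.-1 -> nat) (phi : T -> {linear K -> F^o})
    (psi : 'I_n.-1 -> T -> K -> F) :
    (forall i, answered_by (k i) (psi i)) ->
    (forall x, (forall t, phi t x = 0) -> x = 0) ->
    (forall c, C c -> forall t, phi t (c 0 i0) = \sum_i psi i t (c 0 (lift i0 i))) ->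
  exists S : repair_at C i0, nsub S =1 k.
Proof.
move=> /fin_all_exists[query] /fin_all_exists[rho psiE] phi_inj dualC.
have Phi_lin : linear (fun x => [ffun t => phi t x] : {ffun T -> F^o}).
  by move=> c x y; apply/ffunP => t; rewrite !ffunE linearP.
have R_lin : linear (fun v : 'rV[F]_(\sum_i k i) =>
    [ffun t => \sum_i rho i t (submxrow v i)] : {ffun T -> F^o}).
  move=> c v w; apply/ffunP => t; rewrite !ffunE scaler_sumr -big_split.
  apply: eq_bigr => i _; rewrite /= -linearP; congr (rho i t _).
  by apply/rowP => j; rewrite !mxE.
(* [Phi] is injective; recovery applies its left inverse to the summed answers. *)
pose Phi := linfun (linear_of Phi_lin).
have /lker0_lfunK PhiK : lker Phi == 0%VS.
  rewrite -subv0; apply/subvP => x; rewrite memv_ker lfunE => /eqP /= Phi0.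
  rewrite memv0; apply/eqP/phi_inj => t.
  by have /ffunP/(_ t) := Phi0; rewrite !ffunE.
have rec_lin : linear (Phi^-1%VF \o linear_of R_lin).
  by move=> c v w; rewrite linearP.
unshelve eexists (RepairAt (query := query) (recover := linear_of rec_lin) _) => //.
move=> c /dualC dual_c /=; rewrite -[LHS]PhiK lfunE /=; congr (_ _).
apply/ffunP => t; rewrite !ffunE dual_c; apply: eq_bigr => i _.
by rewrite psiE mxrowK.
Qed.

End LinearRepair.

(** * The trace as a functional over the subfield *)

Section Trace.

Variables (F : finFieldType) (E : fieldExtType F).
Local Notation K := (finvect_type E).
Local Notation q := #|F|.
Local Notation r := (\dim {:E}).

Lemma card_finvect : #|K| = (q ^ r)%N.
Proof.
exact: etrans (esym (card_vspacef _)) (card_vspace (fullv : {vspace K})).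
Qed.

Lemma card_pchar_nat : [pchar K].-nat q.
Proof.
have [p p_pr pK] := finPcharP K.
rewrite (eq_pnat _ (pcharf_eq pK)).
have pF : p \in [pchar F] by rewrite -(fmorph_pchar (in_alg K)).
have /abelem_pgroup := fin_ring_pchar_abelem pF.
by rewrite /pgroup cardsT.
Qed.

Lemma trace_functional :
  exists tr : {linear K -> F^o}, forall x, (tr x)%:A = Tr q r x :> K.
Proof.
have q_gt1 : (1 < q)%N := finNzRing_gt1 F.
have r_gt0 : (0 < r)%N by rewrite adim_gt0.
have tr_lin : linear (fun x : K => coord [tuple (1 : K)] ord0 (Tr q r x) : F^o).
  move=> c x y; rewrite -linearP TrD ?card_pchar_nat // -[c *: x]mulr_algl TrZ.
    by rewrite mulr_algl.
  by rewrite -in_algE -rmorphXn /= expf_card.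
exists (linear_of tr_lin) => x /=.
(* The elements fixed by x -> x^q form the line spanned by 1, where [coord] reads off the scalar. *)
have : Tr q r x \in 1%AS.
  rewrite Fermat's_little_theorem dimv1 expn1.
  by rewrite (Tr_fixed q_gt1 r_gt0 card_finvect card_pchar_nat).
case/vlineP => k ->; rewrite linearZ /=.
by rewrite (coord_free ord0 ord0 (X := [tuple 1])) ?seq1_free ?oner_neq0 // mulr1.
Qed.

End Trace.

(** * Repair of the evaluation code and its bandwidth *)

Section Repair.

Variables (F : finFieldType) (E : fieldExtType F) (u : nat).
Local Notation K := (finvect_type E).
Local Notation q := #|F|.
Local Notation r := (\dim {:E}).
Hypotheses (u_gt0 : (0 < u)%N) (u_dvd : (u %| (q ^ r - 1) %/ (q - 1))%N).
Variable M : {pred 'X_{1..2}}.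
Hypothesis M_sub : {subset M <= Delta ((q - 1) * u) (q ^ (r - 1))}.

Let q_gt1 : (1 < q)%N. Proof. exact: finNzRing_gt1. Qed.
Let r_gt0 : (0 < r)%N. Proof. by rewrite adim_gt0. Qed.
Let X := ntcurve K q r u.
Let pt (i : 'I_#|X|) : K * K := enum_val i.
Let w : K -> K := weight q u.

Lemma ev_code_dual (c : 'rV[K]_#|X|) (h : {poly K}) :
    ev_code M c -> (size h <= q ^ (r - 1))%N ->
  \sum_i w (pt i).1 * h.[(pt i).2] * c 0 i = 0.
Proof.
case=> f f_M -> size_h.
transitivity (\sum_(m <- msupp f) f@_m *
    \sum_(i < #|X|) w (pt i).1 * h.[(pt i).2] * ((pt i).1 ^+ m ix * (pt i).2 ^+ m iy)).
  under [RHS]eq_bigr do rewrite mulr_sumr.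
  rewrite exchange_big; apply: eq_bigr => i _ /=.
  rewrite mxE mevalE mulr_sumr; apply: eq_bigr => m _.
  have iyE : lift ord0 ord0 = iy by apply: val_inj.
  by rewrite mulrCA big_ord_recl big_ord1 iyE.
rewrite big_seq big1 // => m /f_M/M_sub; rewrite inE => /andP[mx my].
have lt_exp k (j : 'I_2) : ~~ (U_(j) *+ k <= m)%MM -> (m j < k)%N.
  apply: contraR; rewrite -leqNgt => km; apply/mnm_lepP => j'.
  rewrite mulmnE mnm1E; case: eqP => [<-|_]; by rewrite ?mul1n ?mul0n.
have := ntcurve_dual q_gt1 r_gt0 (card_finvect E) (card_pchar_nat E) u_gt0 u_dvd
  size_h (lt_exp _ _ mx) (lt_exp _ _ my).
by rewrite big_enum_val => ->; rewrite mulr0.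
Qed.

Lemma ev_code_repair (i0 : 'I_#|X|) :
  exists S : repair_at (K := K) (ev_code M) i0,
    nsub S =1 fun i => if (pt (lift i0 i)).2 == (pt i0).2 then r else 1.
Proof.
have [tr trE] := trace_functional E.
set b0 := (pt i0).2; pose h t : {poly K} := repair_poly q r t b0.
have w0 : w (pt i0).1 != 0.
  have /eqP P0 : (pt i0).1 ^+ u == Tr q r b0 by have := enum_valP i0; rewrite inE.
  apply: (weight_neq0 q_gt1 (card_finvect E) u_gt0 u_dvd).
  by rewrite P0 (Tr_fixed q_gt1 r_gt0 (card_finvect E) (card_pchar_nat E)).
have tr_lin (a : K) : linear (fun x : K => tr (a * x) : F^o).
  by move=> k x y; rewrite mulrDr -scalerAr linearP.
pose mtr a := linear_of (tr_lin a).
pose phi (t : K) := mtr (w (pt i0).1 * t).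
pose a t j := w (pt j).1 * (h t).[(pt j).2].
(* The sign comes from solving the parity check for the term at [i0]. *)
pose psi i t := mtr (- a t (lift i0 i)).
apply: (@repair_from_functionals _ _ K _ _ _ _ phi psi) => [i|x phi0|c Cc t].
- case: eqP => [bi|/eqP bi]; first exact: answered_by_dim.
  pose d := (pt (lift i0 i)).2 - b0.
  have d0 : d != 0 by rewrite subr_eq0.
  pose a1 t := - tr (t * d).
  apply: (answered_by1 (a := a1) (f := mtr (w (pt (lift i0 i)).1 / d))) => t x /=.
  (* The factor Tr(td) lies in [F] and leaves the outer trace, so all t ask for multiples of one
     functional. *)
  have hE : (h t).[(pt (lift i0 i)).2] = tr (t * d) *: d^-1.
    by rewrite -[RHS]mulr_algl trE -(horner_repair_poly _ q_gt1) mulfK.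
  by rewrite /a hE -scalerAr -scaleNr -scalerAl linearZ.
- apply: contraTeq (erefl true) => x0.
  (* If x is nonzero, t = y/(w x) turns the functional's value into Tr(y), which is nonzero. *)
  have [y] := ex_Tr_neq0 q_gt1 r_gt0 (card_finvect E).
  have <- : w (pt i0).1 * (y / (w (pt i0).1 * x)) * x = y.
    by rewrite mulrAC mulrC divfK // mulf_neq0.
  by rewrite -trE [tr _](phi0 _) scale0r eqxx.
- have := ev_code_dual Cc (size_repair_poly q_gt1 r_gt0 t b0).
  rewrite (bigD1_ord i0) //= (horner_repair_poly_center q_gt1 r_gt0) => /eqP.
  rewrite addr_eq0 => /eqP ->; rewrite -sumrN linear_sum /=.
  by apply: eq_bigr => i _; rewrite mulNr.
Qed.

Lemma ev_code_bandwidth (i0 : 'I_#|X|) :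
  (\sum_(i < #|X|.-1) (if (pt (lift i0 i)).2 == (pt i0).2 then r else 1)
     <= #|X| - 1 + (u - 1) * (r - 1))%N.
Proof.
pose k i := if (pt i).2 == (pt i0).2 then r else 1%N.
(* Adding the cost r of [i0] itself makes the sum run over the whole curve, where at most u points
   have ordinate b0. *)
rewrite -(leq_add2l (k i0)) -(bigD1_ord i0 (P := predT)) // {2}/k eqxx.
have -> : (\sum_i k i = #|X| + #|[set P in X | P.2 == (pt i0).2]| * (r - 1))%N.
  transitivity (\sum_(P in X) (1 + if P.2 == (pt i0).2 then r - 1 else 0))%N.
    rewrite [RHS]big_enum_val; apply: eq_bigr => i _; rewrite /k.
    by case: eqP => // _; rewrite subnKC.
  by rewrite big_split sum1_card -big_mkcondr sum_nat_cond_const.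
have card_b := card_ntcurve_fibre q r (pt i0).2 u_gt0.
rewrite (leq_trans (leq_add (leqnn _) (leq_mul card_b (leqnn _)))) //.
have : (0 < #|X|)%N := leq_trans (ltn0Sn _) (ltn_ord i0).
move: #|X| r_gt0 u_gt0 => [//|n]; case: r u => [//|s] [//|v] _ _ _.
by rewrite !subn1 /= mulSn addSn addSn addnCA.
Qed.

End Repair.

(* F is F_q and finvect_type E, which is E as a finite field, is F_(q^r). *)
Theorem theorem6p2 (q r u : nat) (F : finFieldType) (E : fieldExtType F)
    (cardF : #|F| = q) (dimE : \dim {:E} = r)
    (r_ge2 : (2 <= r)%N) (u_gt0 : (0 < u)%N)
    (u_dvd : (u %| (q ^ r - 1) %/ (q - 1))%N)
    (M : {pred 'X_{1..2}})
    (M_sub : {subset M <= Delta ((q - 1) * u) (q ^ (r - 1))})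
    (M_closed : closed_under_divisibility M) :
  let K := finvect_type E in
  let X := ntcurve K q r u in
  exists S : repair_scheme (K := K) (@ev_code K X M),
    bandwidth_at_most S (#|X| - 1 + (u - 1) * (r - 1)).
Proof.
subst q r; move=> K X.
have [S nsubS] := fin_all_exists (ev_code_repair u_gt0 u_dvd M_sub).
exists S => i0; rewrite (eq_bigr _ (fun i _ => nsubS i0 i)).
exact: ev_code_bandwidth.
Qed.
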